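(* Let $\mathcal{S}_1$ be the set of all solutions $X\in\mathbb{C}^{m\times m}$ of $X=Af(X)B+C$ and let $\mathcal{S}_2$ be the set of all solutions $\mathcal{X}\in\mathbb{C}^{m\times m}$ of the Stein matrix equation $\mathcal{X}=\mathcal{A}\mathcal{X}\mathcal{B}+\mathcal{C}$. Then $\mathcal{S}_1=F_f(\mathcal{S}_2)$, i.e. $F_f:\mathcal{S}_2\to\mathcal{S}_1$ is a surjective function; the restriction $F_f:\mathcal{S}_1\to\mathcal{S}_1$ is the identity map; and the following are equivalent: (i) $F_f:\mathcal{S}_2\to\mathcal{S}_1$ is injective; (ii) $F_f(\mathcal{X})=\mathcal{X}$ for all $\mathcal{X}\in\mathcal{S}_2$; (iii) $\mathcal{S}_1=\mathcal{S}_2$.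
   Context: Let $m,n\ge 1$ be integers, $A,B,C\in\mathbb{C}^{m\times m}$, and let $f:\mathbb{C}^{m\times m}\to\mathbb{C}^{m\times m}$ satisfy (1) (''linear'' in the paper's sense) $f(PQ+RS)=f(P)f(Q)+f(R)f(S)$ for all $P,Q,R,S\in\mathbb{C}^{m\times m}$; (2) (period-$n$) $n$ is the least positive integer such that $f^{(n)}(P)=P$ for all $P\in\mathbb{C}^{m\times m}$. Here $f^{(i)}$ is the $i$-fold composition of $f$ with itself, and $f^{(0)}$ is the identity map. For $i\ge 1$ and $X\in\mathbb{C}^{m\times m}$ set $G_i(X)=\Big(\prod_{j=1}^i f^{(j-1)}(A)\Big) f^{(i)}(X)\Big(\prod_{j=1}^i f^{(i-j)}(B)\Big)$, with products ordered from left to right in increasing $j$, i.e. $G_i(X)=A f(A)\cdots f^{(i-1)}(A)\, f^{(i)}(X)\, f^{(i-1)}(B)\cdots f(B)B$; and $G_0(X)=X$. Set $\mathcal{A}=\prod_{i=1}^n f^{(i-1)}(A)=A f(A)\cdots f^{(n-1)}(A)$, $\mathcal{B}=\prod_{i=1}^n f^{(n-i)}(B)=f^{(n-1)}(B)\cdots f(B)B$, and $\mathcal{C}=\sum_{i=1}^{n}G_{i-1}(C)$. Define $F_f:\mathbb{C}^{m\times m}\to\mathbb{C}^{m\times m}$ by $F_f(\mathcal{X})=\frac{1}{n}\sum_{i=0}^{n-1}\big(G_i(\mathcal{X})+(n-i-1)G_i(C)\big)$. *)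

(* Defs.v *)
From mathcomp Require Import all_boot all_order all_algebra.
From mathcomp Require Import boolp classical_sets functions reals complex.

Set Implicit Arguments.
Unset Strict Implicit.
Unset Printing Implicit Defensive.

Import GRing.Theory Num.Theory.
Local Open Scope classical_set_scope.
Local Open Scope ring_scope.

(* The complex field is R[i] over a complete archimedean real field R.       *)
(* Matrices use the ring structure of 'M_m, so _ * _ is the matrix product   *)
(* and \prod multiplies from left to right in increasing index.              *)

(* Not linearity over the scalars: complex conjugation of the entries is     *)
(* allowed, for instance.                                                    *)
Definition sum_of_products_preserving (K : fieldType) (m : nat)
    (f : 'M[K]_m -> 'M[K]_m) : Prop :=
  forall P Q R S : 'M[K]_m, f (P * Q + R * S) = f P * f Q + f R * f S.

Definition has_period (T : Type) (n : nat) (f : T -> T) : Prop :=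
  [/\ (0 < n)%N,
      forall P, iter n f P = P
    & forall k : nat, (0 < k)%N -> (forall P, iter k f P = P) -> (n <= k)%N].

Section SteinObjects.
Context (K : fieldType) (m n : nat).
Context (f : 'M[K]_m -> 'M[K]_m) (A B C : 'M[K]_m).

Definition Gmap (i : nat) (X : 'M[K]_m) : 'M[K]_m :=
  (\prod_(1 <= j < i.+1) iter (j - 1) f A) * iter i f X *
  (\prod_(1 <= j < i.+1) iter (i - j) f B).

Lemma Gmap0 (X : 'M[K]_m) : Gmap 0 X = X.
Proof. by rewrite /Gmap !big_nil mul1r mulr1. Qed.

Definition calA : 'M[K]_m := \prod_(1 <= i < n.+1) iter (i - 1) f A.

Definition calB : 'M[K]_m := \prod_(1 <= i < n.+1) iter (n - i) f B.

Definition calC : 'M[K]_m := \sum_(1 <= i < n.+1) Gmap (i - 1) C.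

(* The truncated subtraction n - i - 1 is exact, as i < n. *)
Definition Fmap (X : 'M[K]_m) : 'M[K]_m :=
  n%:R^-1 *: \sum_(0 <= i < n) (Gmap i X + Gmap i C *+ (n - i - 1)).

Definition sol1 : set 'M[K]_m := [set X | X = A * f X * B + C].

Definition sol2 : set 'M[K]_m := [set X | X = calA * X * calB + calC].

End SteinObjects.

(* Main.v *)
(** [f] turns out to be a unital ring automorphism, so the affine map
    [U X = A * f X * B + C] has an additive linear part [T], for which
    [Gmap i] is the [i]-th iterate.  Hence [sol1] is the set of fixed points of
    [U], [sol2] the set of fixed points of [iter n U], and [Fmap] is the average
    of [X, U X, ..., iter (n - 1) U X].  As [U] preserves averages, the average
    of an [n]-periodic orbit is a fixed point of [U]. *)
Require Import Defs.
From HB Require Import structures.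
From mathcomp Require Import all_boot all_order all_algebra.
From mathcomp Require Import boolp classical_sets functions reals complex.

Set Implicit Arguments.
Unset Strict Implicit.
Unset Printing Implicit Defensive.

Import GRing.Theory Num.Theory.
Local Open Scope classical_set_scope.
Local Open Scope ring_scope.

Section PeriodicSumOfProducts.
Context (K : fieldType) (m n : nat) (f : 'M[K]_m -> 'M[K]_m).
Hypotheses (hf : sum_of_products_preserving f) (hper : has_period n f).

Lemma has_period_surj Y : exists X, f X = Y.
Proof.
have [n_gt0 fnK _] := hper; exists (iter n.-1 f Y).
by rewrite -iterS prednK.
Qed.

(* Plugging a zero [Q0] of [f] into [hf] gives [f 0 = f 0 * f 0], whereas
   [hf 0 0 0 0] gives [f 0 = f 0 * f 0 + f 0 * f 0]. *)
Lemma sop_periodic0 : f 0 = 0.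
Proof.
have [Q0 fQ0] := has_period_surj 0.
have := hf 0 Q0 0 0; rewrite fQ0 !(mulr0, mul0r, add0r) => f0E.
by have := hf 0 0 0 0; rewrite !mulr0 addr0 -f0E => /eqP;
  rewrite -subr_eq subrr => /eqP <-.
Qed.

Lemma sop_periodicM : {morph f : X Y / X * Y}.
Proof.
by move=> X Y; have := hf X Y 0 0; rewrite sop_periodic0 !mulr0 !addr0.
Qed.

(** Surjectivity provides a preimage [e] of [1], and multiplicativity gives
    [1 = f (e * 1) = f e * f 1 = f 1]. *)
Lemma sop_periodic1 : f 1 = 1.
Proof.
have [e fe] := has_period_surj 1.
by have := sop_periodicM e 1; rewrite mulr1 fe mul1r => <-.
Qed.

Lemma sop_periodicD : {morph f : X Y / X + Y}.
Proof.
by move=> X Y; have := hf X 1 Y 1; rewrite sop_periodic1 !mulr1.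
Qed.

Lemma sop_periodic_prod (r : seq nat) (F : nat -> 'M[K]_m) :
  f (\prod_(i <- r) F i) = \prod_(i <- r) f (F i).
Proof. exact: (big_morph f sop_periodicM sop_periodic1). Qed.

Lemma sandwich_zmod_morphism (A B : 'M[K]_m) :
  zmod_morphism (fun X => A * f X * B).
Proof.
move=> X Y; have fB : f (X - Y) = f X - f Y.
  by apply/eqP; rewrite eq_sym subr_eq -sop_periodicD subrK.
by rewrite fB mulrBr mulrBl.
Qed.

Lemma Gmap_iter (A B : 'M[K]_m) i X :
  Gmap f A B i X = iter i (fun Y => A * f Y * B) X.
Proof.
elim: i => [|i IHi]; first by rewrite Gmap0.
rewrite iterS -IHi /Gmap !sop_periodicM !sop_periodic_prod.
(* Pushing [f] inside raised every exponent by one; the outer [A] and [B] supply the missing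
   exponent [0], as first factor on the left and last factor on the right. *)
rewrite [X in X * _ * _]big_nat_recl // [X in _ * _ * X]big_nat_recr //=.
rewrite subnn !mulrA -iterS; congr (_ * _ * _ * _).
  congr (_ * _); rewrite !big_add1 /=; apply: eq_bigr => j _.
  by rewrite -iterS !subSS !subn0.
by apply: eq_big_nat => j /andP[_]; rewrite ltnS => ji; rewrite -iterS subSn.
Qed.

End PeriodicSumOfProducts.

Section AffineOrbits.
Context (K : fieldType) (V : lmodType K) (T : {additive V -> V}) (C : V).

Let U X := T X + C.

Lemma iter_affine k X : iter k U X = iter k T X + \sum_(0 <= i < k) iter i T C.
Proof.
elim: k => [|k IHk]; first by rewrite big_nil addr0.
by rewrite !iterS IHk /U raddfD raddf_sum big_nat_recl //= -addrA [C + _]addrC.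
Qed.

(** By [iter_affine], [iter i T C] occurs in [iter k U X] exactly when [i < k], hence for
    [n - i - 1] values of [k] below [n]. *)
Lemma sum_iter_affine n X :
  \sum_(0 <= k < n) iter k U X =
  \sum_(0 <= i < n) (iter i T X + iter i T C *+ (n - i - 1)).
Proof.
elim: n => [|n IHn]; first by rewrite !big_nil.
rewrite !big_nat_recr //= IHn iter_affine subSnn subnn mulr0n addr0.
rewrite [iter n T X + _]addrC addrA -big_split /=; congr (_ + _).
apply: eq_big_nat => i /andP[_ lt_in].
by rewrite -addrA -mulrSr subSn ?(ltnW lt_in) // !subn1 /= prednK ?subn_gt0.
Qed.

Context (n : nat).
Hypothesis n_neq0 : n%:R != 0 :> K.

Definition orbit_mean X := (n%:R^-1 : K) *: \sum_(0 <= k < n) iter k U X.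

(** [T] need not be [K]-linear, but multiplication by [n] is repeated addition, so [T] commutes with
    it and with its inverse. *)
Lemma additive_invn_scale (X : V) : T ((n%:R^-1 : K) *: X) = (n%:R^-1 : K) *: T X.
Proof.
apply: (scalerI n_neq0); rewrite scalerA divff // scale1r.
by rewrite scaler_nat -raddfMn -scaler_nat scalerA divff // scale1r.
Qed.

Lemma mean_const (X : V) : (n%:R^-1 : K) *: (\sum_(0 <= k < n) X) = X.
Proof. by rewrite sumr_const_nat subn0 -scaler_nat scalerA mulVf ?scale1r. Qed.

Lemma orbit_mean_fixed X : iter n U X = X -> U (orbit_mean X) = orbit_mean X.
Proof.
move=> UnX; rewrite /U /orbit_mean additive_invn_scale raddf_sum.
rewrite -[X in _ + X]mean_const -scalerDr -big_split /=; congr (_ *: _).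
(* [U] shifts the orbit by one place. With [X] added, both sides are the sum of [n.+1] orbit terms,
   split at its first term or at its last, which is [X] again by periodicity. *)
apply: (addrI X); transitivity (\sum_(0 <= k < n.+1) iter k U X).
  by rewrite big_nat_recl.
by rewrite big_nat_recr //= UnX addrC.
Qed.

Lemma orbit_mean_id X : U X = X -> orbit_mean X = X.
Proof.
move=> UX; rewrite /orbit_mean -[RHS]mean_const; congr (_ *: _).
by apply: eq_bigr => k _; apply: iter_fix.
Qed.

End AffineOrbits.

Lemma retraction_tfae (T : Type) (S1 S2 : set T) (F : T -> T) :
  S1 `<=` S2 -> set_fun S2 S1 F -> (forall x, S1 x -> F x = x) ->
  [/\ S1 = F @` S2,
      set_fun S2 S1 F /\ set_surj S2 S1 F,
      set_fun S1 S1 F /\ (forall x, S1 x -> F x = x)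
    & [<-> set_inj S2 F;
           forall x, S2 x -> F x = x;
           S1 = S2]].
Proof.
move=> S12 F21 Fid.
have F_surj : set_surj S2 S1 F by move=> x S1x; exists x; [exact: S12|exact: Fid].
split=> //.
- by apply/seteqP; split=> [//|_ [x S2x <-]]; exact: F21.
- by split=> // x S1x; rewrite /= Fid.
tfae.
(* [F x] lies in [S1], hence in [S2], and [F (F x) = F x]; injectivity cancels the outer [F]. *)
- move=> F_inj x S2x; have S1Fx := F21 _ S2x.
  by apply: F_inj; rewrite ?inE //; [exact: S12|exact: Fid].
- move=> F2id; apply/seteqP; split=> // x S2x.
  by rewrite -[x]F2id //; exact: F21.
- by move=> S1E x y; rewrite !inE -S1E => S1x S1y; rewrite !Fid.
Qed.

Theorem mainTheorem2 (R : realType) (m n : nat) (hm : (0 < m)%N) (hn : (0 < n)%N)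
    (A B C : 'M[R[i]]_m) (f : 'M[R[i]]_m -> 'M[R[i]]_m)
    (hf : sum_of_products_preserving f) (hper : has_period n f) :
  let S1 := sol1 f A B C in
  let S2 := sol2 n f A B C in
  let F := Fmap n f A B C in
  [/\ S1 = F @` S2,
      set_fun S2 S1 F /\ set_surj S2 S1 F,
      set_fun S1 S1 F /\ (forall X, S1 X -> F X = X)
    & [<-> set_inj S2 F;
           forall X, S2 X -> F X = X;
           S1 = S2]].
Proof.
move=> S1 S2 F.
pose T : {additive 'M[R[i]]_m -> 'M[R[i]]_m} :=
  HB.pack (fun X => A * f X * B)
    (GRing.isZmodMorphism.Build _ _ _ (sandwich_zmod_morphism hf hper A B)).
pose U X := T X + C.
have n_neq0 : n%:R != 0 :> R[i] by rewrite pnatr_eq0 -lt0n.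
have FE X : F X = orbit_mean T C n X.
  rewrite /F /Fmap /orbit_mean sum_iter_affine; congr (_ *: _).
  by apply: eq_bigr => i _; rewrite !(Gmap_iter hf hper).
have S1E X : S1 X <-> U X = X by split=> /esym.
have S2E X : S2 X <-> iter n U X = X.
  have -> : iter n U X = calA n f A * X * calB n f B + calC n f A B C.
    rewrite iter_affine; congr (_ + _).
      (* Since [iter n f X = X], the product [calA * X * calB] is [Gmap n X]. *)
      by have [_ fn _] := hper; rewrite -[X in RHS](fn X) -(Gmap_iter hf hper).
    rewrite /calC big_add1 /=; apply: eq_bigr => i _.
    by rewrite (Gmap_iter hf hper) subn1.
  by split=> /esym.
apply: retraction_tfae => [X /S1E UX|X /S2E UnX|X /S1E UX].
- by apply/S2E/iter_fix.
- by apply/S1E; rewrite FE; exact: orbit_mean_fixed.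
- by rewrite FE; exact: orbit_mean_id.
Qed.
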